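(* Let $G$ be a countable group such that the abelianization $G_{ab}=G/G'$ is a free abelian group. Then $G$ embeds in some $2$-generated subgroup $H$ of the Cartesian wreath product $G\ \mathrm{Wr}\ \mathbb{Z}$.
   Context: Countable means finite or countably infinite. $G'$ denotes the derived subgroup of $G$. A group is $k$-generated if it can be generated by $k$ elements (not necessarily distinct). $\mathbb{Z}$ is the infinite cyclic group. For groups $A$ and $B$, let $D$ be the group of all functions $f:B\to A$ with pointwise multiplication. $B$ acts on $D$ by $f^b(x)=f(bx)$ for $f\in D$, $b,x\in B$. The associated semidirect product $D\rtimes B$ (in which $b^{-1}fb=f^b$) is the Cartesian wreath product $A\ \mathrm{Wr}\ B$. *)

(* Defs.v *)
(* [groupType] does not require finiteness. *)
From HB Require Import structures.
From mathcomp Require Import all_boot all_algebra.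
From mathcomp Require Import boolp classical_sets functions cardinality.
From mathcomp Require Import freeg.

Set Implicit Arguments.
Unset Strict Implicit.
Unset Printing Implicit Defensive.

Local Open Scope classical_set_scope.
Local Open Scope quotient_scope.
Local Open Scope group_scope.

Section Subgroups.
Variable G : groupType.
Implicit Types (A H : set G) (x y : G).

Definition subgroup H :=
  [/\ H 1, (forall x y, H x -> H y -> H (x * y)) & (forall x, H x -> H x^-1)].

Definition generated A : set G := smallest subgroup A.

(* The k generators need not be distinct. *)
Definition k_generated (k : nat) H :=
  exists s : 'I_k -> G, H = generated (range s).

Definition derived : set G := generated [set [~ x, y] | x in setT & y in setT].

Lemma generated_subgroup A : subgroup (generated A).
Proof.
split=> [H [[H1 _ _] _]|x y gx gy H HA|x gx H HA]; first exact: H1.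
- by case: (HA) => -[_ HM _] _; apply: HM; [exact: gx|exact: gy].
- by case: (HA) => -[_ _ HV] _; apply: HV; exact: gx.
Qed.

Lemma derived_subgroup : subgroup derived.
Proof. exact: generated_subgroup. Qed.

Lemma derivedM x y : derived x -> derived y -> derived (x * y).
Proof. by case: derived_subgroup => _ + _; apply. Qed.

Lemma derivedV x : derived x -> derived x^-1.
Proof. by case: derived_subgroup => _ _; apply. Qed.

Lemma derived_comm x y : derived [~ x, y].
Proof. by apply: sub_gen_smallest; exists x => //; exists y. Qed.

Lemma derived_conj x y : derived x -> derived (x ^ y).
Proof.
move=> dx.
have -> : x ^ y = x * [~ x, y] by rewrite /commg mulVKg.
by apply: derivedM => //; exact: derived_comm.
Qed.

End Subgroups.

Section Abelianization.
Variable G : groupType.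
Implicit Types x y z : G.

Definition ab_rel : rel G := fun x y => `[< derived (x^-1 * y) >].

Lemma ab_relP : equiv_class_of ab_rel.
Proof.
split=> [x|x y|y x z]; rewrite /ab_rel.
- by apply/asboolP; rewrite mulVg; case: (derived_subgroup G).
- by apply/asboolP/asboolP => /derivedV; rewrite invgM invgK.
- move=> /asboolP xy /asboolP yz; apply/asboolP.
  by have := derivedM xy yz; rewrite -mulgA mulVKg.
Qed.

Canonical ab_equiv := EquivRelPack ab_relP.

(* The quotient G / G' by the classes of x ~ y <-> x^-1 y \in G'. *)
Definition abelianization := {eq_quot ab_equiv}.

HB.instance Definition _ := Choice.on abelianization.
HB.instance Definition _ := EqQuotient.on abelianization.

Lemma pi_ab_eq x y :
  \pi_abelianization x = \pi_abelianization y <-> derived (x^-1 * y).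
Proof.
split=> [/eqmodP/asboolP //|dxy]; apply/eqmodP; exact/asboolP.
Qed.

Definition ab_mul (a b : abelianization) : abelianization :=
  \pi_abelianization (repr a * repr b).
Definition ab_inv (a : abelianization) : abelianization :=
  \pi_abelianization (repr a)^-1.
Definition ab_one : abelianization := \pi_abelianization 1.

Lemma ab_mulE x y : ab_mul (\pi x) (\pi y) = \pi_abelianization (x * y).
Proof.
have rE z : derived ((repr (\pi_abelianization z))^-1 * z).
  by apply/pi_ab_eq; rewrite reprK.
apply/pi_ab_eq; set x' := repr _; set y' := repr _.
have -> : (x' * y')^-1 * (x * y) = (x'^-1 * x) ^ y' * (y'^-1 * y).
  by rewrite /conjg invgM !mulgA mulgK.
by apply: derivedM; [apply: derived_conj|]; apply: rE.
Qed.

Lemma ab_invE x : ab_inv (\pi x) = \pi_abelianization x^-1.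
Proof.
apply/pi_ab_eq; set x' := repr _; rewrite invgK.
have rE : derived (x'^-1 * x) by apply/pi_ab_eq; rewrite reprK.
have -> : x' * x^-1 = ((x'^-1 * x)^-1) ^ x'^-1.
  by rewrite /conjg invgM !invgK mulgK.
by apply: derived_conj; apply: derivedV.
Qed.

Lemma ab_mulA : associative ab_mul.
Proof.
move=> a b c; rewrite -[a]reprK -[b]reprK -[c]reprK.
by rewrite !ab_mulE mulgA.
Qed.
Lemma ab_mul1g : left_id ab_one ab_mul.
Proof. by move=> a; rewrite -[a]reprK ab_mulE mul1g. Qed.
Lemma ab_mulg1 : right_id ab_one ab_mul.
Proof. by move=> a; rewrite -[a]reprK ab_mulE mulg1. Qed.
Lemma ab_mulVg : left_inverse ab_one ab_inv ab_mul.
Proof. by move=> a; rewrite -[a]reprK ab_invE ab_mulE mulVg. Qed.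
Lemma ab_mulgV : right_inverse ab_one ab_inv ab_mul.
Proof. by move=> a; rewrite -[a]reprK ab_invE ab_mulE mulgV. Qed.

HB.instance Definition _ := isGroup.Build abelianization
  ab_mulA ab_mul1g ab_mulg1 ab_mulVg ab_mulgV.

Lemma pi_abM : {morph \pi_abelianization : x y / x * y >-> (x * y : abelianization)}.
Proof. by move=> x y; exact: esym (ab_mulE x y). Qed.

Lemma pi_ab1P x : \pi_abelianization x = 1 <-> derived x.
Proof.
rewrite -[1]/(\pi_abelianization 1); split=> [/esym/pi_ab_eq|dx].
  by rewrite invg1 mul1g.
by apply/esym/pi_ab_eq; rewrite invg1 mul1g.
Qed.

End Abelianization.

(* [{freeg I}] is the library's additive group of finite formal sums of elements
   of I with coefficients in [int]. *)
Definition free_abelian (A : groupType) :=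
  exists (I : choiceType) (f : {multiplicative A -> Algebra.to_multiplicative {freeg I}}),
    bijective f.

Section Wreath.
Variables A B : groupType.

(* [Wreath f b] stands for the product f b of f in the base group D and b in B. *)
Record wreath := Wreath { wr_base : B -> A; wr_top : B }.

HB.instance Definition _ := gen_eqMixin wreath.
HB.instance Definition _ := gen_choiceMixin wreath.

Definition base_act (f : B -> A) (b : B) : B -> A := fun x => f (b * x).

(* (f b) (g c) = (f g^(b^-1)) (b c). *)
Definition wr_mul (u v : wreath) :=
  Wreath (fun x => wr_base u x * base_act (wr_base v) (wr_top u)^-1 x)
         (wr_top u * wr_top v).
Definition wr_one := Wreath (fun=> 1) 1.
Definition wr_inv (u : wreath) :=
  Wreath (base_act (fun x => (wr_base u x)^-1) (wr_top u)) (wr_top u)^-1.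

Lemma wr_mulA : associative wr_mul.
Proof.
move=> [f b] [g c] [h d]; rewrite /wr_mul /base_act /= mulgA; congr Wreath.
by apply/funext => x; rewrite invgM !mulgA.
Qed.
Lemma wr_mul1g : left_id wr_one wr_mul.
Proof.
move=> [f b]; rewrite /wr_mul /base_act /= mul1g; congr Wreath.
by apply/funext => x; rewrite invg1 !mul1g.
Qed.
Lemma wr_mulg1 : right_id wr_one wr_mul.
Proof.
move=> [f b]; rewrite /wr_mul /base_act /= mulg1; congr Wreath.
by apply/funext => x; rewrite mulg1.
Qed.
Lemma wr_mulVg : left_inverse wr_one wr_inv wr_mul.
Proof.
move=> [f b]; rewrite /wr_mul /wr_one /base_act /= mulVg; congr Wreath.
by apply/funext => x; rewrite invgK mulVg.
Qed.
Lemma wr_mulgV : right_inverse wr_one wr_inv wr_mul.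
Proof.
move=> [f b]; rewrite /wr_mul /wr_one /base_act /= mulgV; congr Wreath.
by apply/funext => x; rewrite /base_act mulVKg mulgV.
Qed.

HB.instance Definition _ := isGroup.Build wreath
  wr_mulA wr_mul1g wr_mulg1 wr_mulVg wr_mulgV.

Lemma wreathE (f : B -> A) (b : B) :
  Wreath f b = Wreath f 1 * Wreath (fun=> 1) b.
Proof.
rewrite -[RHS]/(wr_mul _ _) /wr_mul /base_act /= mul1g; congr Wreath.
by apply/funext => x; rewrite mulg1.
Qed.

Lemma base_actE (f : B -> A) (b : B) :
  (Wreath (fun=> 1) b)^-1 * Wreath f 1 * Wreath (fun=> 1) b
  = Wreath (base_act f b) 1.
Proof.
rewrite -[LHS]/(wr_mul (wr_mul (wr_inv _) _) _) /wr_mul /wr_inv /base_act /=.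
rewrite mulg1 mulVg; congr Wreath.
by apply/funext => x; rewrite invg1 mul1g mulg1 invgK.
Qed.

End Wreath.

(* Main.v *)
Require Import Defs.
From HB Require Import structures.
From mathcomp Require Import all_boot all_algebra.
From mathcomp Require Import boolp classical_sets functions cardinality.
From mathcomp Require Import freeg zify.

Set Implicit Arguments.
Unset Strict Implicit.
Unset Printing Implicit Defensive.

(** The functions from [Z] to [G] form the base group of the wreath product.
    Enumerate [G] as [a_0, a_1, ...] and let [phi] carry [a_k] at the integer
    [2^k] and 1 at all other integers. The group generated by [phi] and the
    generator of [Z] contains the translates
    [row i p = phi (2^i + p)], with [row i 0 = a_i] and
    [row i (2^k - 2^i) = a_k].

    The powers of two form a Sidon set: a nonzero integer is a difference
    [2^k - 2^i] in at most one way ([eq_pow2D]). So the supports of two different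
    rows meet only at 0 ([rows_meet]), and the commutator of rows [i] and [j] is
    the function with the single value [[~ a_i, a_j]] at 0. Hence the two-generated
    group contains every function that takes a value in [G'] at 0 and is trivial
    elsewhere ([two_gen_spike]).

    Now let the basis of [G / G'] be the images of some [a_k], [k] in [B], and let
    [c k : G -> int] be the corresponding coordinate map, with [c k = 0] if [k] is
    not in [B]. Send [g] to the function [embed g] with value [g] at 0 and
    [(row i p)^(c i g)] at a nonzero [p], where [i] is the only row whose support
    may contain [p]. At each nonzero [p] this is a homomorphism from [G] to a cyclic
    group, so [embed] is a homomorphism, and it is injective because of the value
    at 0. It sends [a_k], [k] in [B], exactly to row [k], because all other
    coordinates of [a_k] vanish. It sends [g] in [G'] to the function supported
    at 0 with value [g]. The elements that [embed] sends into the two-generated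
    group therefore form a subgroup that contains [G'] and lifts of a basis
    of [G / G'], that is, all of [G] ([two_gen_embed]). *)

Local Open Scope classical_set_scope.
Local Open Scope quotient_scope.
Local Open Scope group_scope.

(** * Sums of two powers of two *)

(** Binary notation: a sum of two powers of two determines both, up to order.
    The induction removes the last bit. *)
Lemma eq_pow2D i j k l :
  (2 ^ i + 2 ^ l = 2 ^ k + 2 ^ j -> i = k \/ i = j)%N.
Proof.
have pos n : (0 < 2 ^ n)%N by rewrite expn_gt0.
elim: i j k l => [|i IHi] j k l.
  case: k j => [|k] [|j]; try by left + right.
  case: l => [|l]; rewrite !expnS ?expn0 => e; last by lia.
  by have := pos k; have := pos j; lia.
case: k j l => [|k] [|j] [|l]; rewrite ?expnS ?expn0 => e.
- by have := pos i; lia.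
- by have := pos i; have := pos l; lia.
- right; apply/eqP; rewrite -(@eqn_exp2l 2) // !expnS; lia.
- by lia.
- left; apply/eqP; rewrite -(@eqn_exp2l 2) // !expnS; lia.
- by lia.
- by lia.
- have /IHi : (2 ^ i + 2 ^ l = 2 ^ k + 2 ^ j)%N by lia.
  by case=> ->; [left|right].
Qed.

(** * Integer powers in a group *)

Section IntegerPowers.
Variable G : groupType.
Implicit Type x : G.

Definition zpow x (n : int) : G :=
  match n with Posz m => x ^+ m | Negz m => x ^- m.+1 end.

Lemma zpow0 x : zpow x 0%R = 1. Proof. by []. Qed.

Lemma zpow1 x : zpow x 1%R = x. Proof. by []. Qed.

Lemma zpowN x (m : nat) : zpow x (- m%:Z)%R = x ^- m.
Proof. by case: m => [|m] //=; rewrite expg0 invg1. Qed.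

Lemma zpow_succ x n : zpow x (1 + n)%R = x * zpow x n.
Proof.
case: n => m; first by rewrite -PoszD /= add1n expgS.
have -> : (1 + Negz m = - m%:Z)%R by lia.
by rewrite zpowN /= expgSr invgM mulVKg.
Qed.

Lemma zpow_pred x n : zpow x (n - 1)%R = x^-1 * zpow x n.
Proof.
have := zpow_succ x (n - 1); rewrite GRing.addrC GRing.subrK => ->.
by rewrite mulKg.
Qed.

Lemma zpowD x m n : zpow x (m + n)%R = zpow x m * zpow x n.
Proof.
elim: m => [|m IHm|m IHm].
- by rewrite GRing.add0r zpow0 mul1g.
- by rewrite intS -GRing.addrA !zpow_succ IHm mulgA.
- have -> : (- m.+1%:Z = - m%:Z - 1)%R by lia.
  by rewrite GRing.addrAC !zpow_pred IHm mulgA.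
Qed.

End IntegerPowers.

(** * Coordinates modulo the derived subgroup *)

Section SubgroupFacts.
Variable G : groupType.

Lemma subgroup_comm (H : set G) x y :
  subgroup H -> H x -> H y -> H [~ x, y].
Proof.
case=> _ HM HV Hx Hy; rewrite /commg /conjg.
apply: (HM); first exact: HV.
by apply: (HM); [exact: HV|exact: HM].
Qed.

Section AdditiveMaps.
Variables (V : zmodType) (c : G -> V).
Hypothesis cM : {morph c : x y / x * y >-> (x + y)%R}.

Lemma additive1 : c 1 = 0%R.
Proof. by apply: (GRing.addrI (c 1)); rewrite -cM mulg1 GRing.addr0. Qed.

Lemma additiveV x : c x^-1 = (- c x)%R.
Proof. by apply: (GRing.addrI (c x)); rewrite -cM mulgV GRing.addrN additive1. Qed.

Lemma additive_derived x : derived x -> c x = 0%R.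
Proof.
suff : derived (G := G) `<=` [set y | c y = 0%R] by apply.
apply: smallest_sub.
  split=> [|y z|y] /=; first exact: additive1.
    by move=> cy cz; rewrite cM cy cz GRing.addr0.
  by rewrite additiveV => ->; rewrite GRing.oppr0.
move=> _ [y _ [z _ <-]]; rewrite /= /commg /conjg !cM !additiveV.
by rewrite GRing.addrCA GRing.addKr GRing.addNr.
Qed.

End AdditiveMaps.

(** The basis of the abelianization is indexed here by the places [B] in the
    enumeration [a] of chosen lifts, because the places are what the
    wreath product construction sees: row [k] is the translate that carries [a_k]
    at 0. Extending the coordinate maps by 0 to all places allows for an empty
    basis. Stating generation modulo [G'] by subgroups replaces the expansion of an
    element as a finite product of lifts by an induction. *)
Lemma free_abelian_coordinates (a : nat -> G) :
  free_abelian (abelianization G) -> (forall x, exists k, a k = x) ->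
  exists (B : set nat) (c : nat -> G -> int),
    [/\ forall l, {morph c l : x y / x * y >-> (x + y)%R},
        forall k l, B k -> c l (a k) = (l == k)%:Z%R &
        forall S : set G, subgroup S -> derived (G := G) `<=` S ->
          (forall k, B k -> S (a k)) -> forall x, S x].
Proof.
move=> [I [F [F' F'K FK]]] a_surj.
pose q x : {freeg I} := F (\pi_(abelianization G) x).
have qM : {morph q : x y / x * y >-> (x + y)%R}.
  by move=> x y; rewrite /q pi_abM gmulfM.
have /choice[s qs] : forall i, exists k, q (a k) = << i >>.
  move=> i; have [k ak] := a_surj (repr (F' << i >>)).
  by exists k; rewrite /q ak reprK FK.
have s_inj : injective s.
  move=> i j e; have := coeffU (1 : int)%R i i.
  by rewrite -qs e qs coeffU eqxx; case: eqP.
have /choice[c cP] : forall l, exists c : G -> int,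
    {morph c : x y / x * y >-> (x + y)%R} /\
    forall i, c (a (s i)) = (l == s i)%:Z%R.
  move=> l; have [[i ->]|Nl] := pselect (exists i, l = s i).
    exists (fun x => coeff i (q x)); split=> [x y|j].
      by rewrite qM coeffD.
    by rewrite qs coeffU GRing.mul1r (inj_eq s_inj) eq_sym; case: eqP.
  exists (fun=> 0%R); split=> // i; case: eqP => // e.
  by case: Nl; exists i.
exists (range s), c; split.
- by move=> l; case: (cP l).
- by move=> _ l [i _ <-]; case: (cP l).
move=> S [S1 SM SV] dS sS x.
pose Q (D : {freeg I}) := exists2 y, S y & q y = D.
suff [y Sy /(can_inj F'K)/pi_ab_eq/dS Syx] : Q (q x).
  by rewrite -(mulVKg y x); apply: SM.
(* Q is a subgroup of the free abelian group that contains the basis. *)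
have QD D1 D2 : Q D1 -> Q D2 -> Q (D1 + D2)%R.
  move=> [y1 Sy1 <-] [y2 Sy2 <-]; exists (y1 * y2); first exact: SM.
  by rewrite qM.
have QU i : Q << i >> by exists (a (s i)); [apply: sS; exists i|].
have QN D : Q D -> Q (- D)%R.
  by move=> [y Sy <-]; exists y^-1; [exact: SV|exact: additiveV].
have Q0 : Q 0%R by exists 1; [|exact: additive1].
elim/freeg_ind_dom0: (q x) => // k i D _ _; apply: (QD).
elim: k => [|k IHk|k IHk].
- suff -> : << (0%R : int) *g i >> = 0%R :> {freeg I} by [].
  by apply/eqP/freeg_eqP => j; rewrite coeffU coeff0 GRing.mul0r.
- by rewrite intS -freegUD; apply: QD.
- rewrite intS GRing.opprD -freegUD; apply: QD => //.
  by rewrite -freegUN; apply: QN.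
Qed.

End SubgroupFacts.

(** * The base group *)

Section Base.
Variables A B : groupType.

Definition base (f : B -> A) : wreath A B := Wreath f 1.

Lemma base_inj : injective base.
Proof. by move=> f g []. Qed.

Lemma baseM f g : base f * base g = base (fun x => f x * g x).
Proof.
rewrite -[LHS]/(wr_mul _ _) /wr_mul /base_act /= mulg1; congr Wreath.
by apply/funext => x; rewrite invg1 mul1g.
Qed.

Lemma baseV f : (base f)^-1 = base (fun x => (f x)^-1).
Proof.
rewrite -[LHS]/(wr_inv _) /wr_inv /base_act /= invg1; congr Wreath.
by apply/funext => x; rewrite mul1g.
Qed.

Lemma baseR f g : [~ base f, base g] = base (fun x => [~ f x, g x]).
Proof. by rewrite /commg /conjg !baseV !baseM. Qed.

End Base.

(** * The two-generated subgroup and the embedding *)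

Section Embedding.
Variables (G : groupType) (a : nat -> G).
Local Notation Z := (Algebra.to_multiplicative int).
Implicit Types (p : int) (i j k : nat) (g : G).

Definition pow2 k : int := (2 ^ k)%N.

(** The test separates a true exponent of [p] from the default value 0 of the
    choice, which is returned if [p] is not a power of two. *)
Definition spread p : G :=
  let k := xget 0%N [set k | p = pow2 k] in if p == pow2 k then a k else 1.

Lemma pow2_inj : injective pow2.
Proof. by move=> i j [] /eqP; rewrite eqn_exp2l // => /eqP. Qed.

Lemma spread_pow2 k : spread (pow2 k) = a k.
Proof.
rewrite /spread (@xget_unique _ _ _ k) ?eqxx // => j.
by move/pow2_inj.
Qed.

Lemma spread_neq1 p : spread p <> 1 -> exists k, p = pow2 k.
Proof. by rewrite /spread; case: eqP => // ? _; eexists; eassumption. Qed.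

Definition row i p : G := spread (pow2 i + p)%R.

Lemma row0 i : row i 0%R = a i.
Proof. by rewrite /row GRing.addr0 spread_pow2. Qed.

(** The Sidon property of the powers of two: [p = 2^k - 2^i = 2^l - 2^j] forces [i = j]. *)
Lemma rows_meet i j p k l : p <> 0%R ->
  (pow2 i + p = pow2 k)%R -> (pow2 j + p = pow2 l)%R -> i = j.
Proof.
move=> p0 ek el; case: (@eq_pow2D i k j l).
- by move: ek el; rewrite /pow2; lia.
- by [].
- by move=> e; case: p0; move: ek; rewrite e; lia.
Qed.

Definition spike g : wreath G Z := base (fun p : Z => if p == 0%R then g else 1).

Definition shift (z : int) : wreath G Z := Wreath (fun=> 1) (z : Z).

Definition gens (k : 'I_2) : wreath G Z :=
  if k == ord0 then base (spread : Z -> G) else shift 1%R.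

Definition two_gen := generated (range gens).

Lemma two_gen_subgroup : subgroup two_gen.
Proof. exact: generated_subgroup. Qed.

(** Conjugation by the [2^i]-th power of the shift translates [spread] by [2^i]. *)
Lemma two_gen_row i : two_gen (base (row i : Z -> G)).
Proof.
have [H1 HM HV] := two_gen_subgroup.
have Hs (n : nat) : two_gen (shift n).
  elim: n => [|n IHn]; first exact: H1.
  have -> : shift n.+1 = shift 1%R * shift n.
    rewrite -[RHS]/(wr_mul _ _) /wr_mul /shift /=.
    by congr Wreath; apply/funext => x; rewrite mulg1.
  apply: HM => //; apply: sub_gen_smallest; exists ord_max => //.
rewrite -[base _]/(Wreath (base_act (spread : Z -> G) (pow2 i : Z)) 1) -base_actE.
apply: (HM); last exact: Hs.
apply: (HM); first by apply: HV; exact: Hs.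
by apply: sub_gen_smallest; exists ord0.
Qed.

Lemma two_gen_spike_comm i j : two_gen (spike [~ a i, a j]).
Proof.
suff -> : spike [~ a i, a j] = [~ base (row i : Z -> G), base (row j : Z -> G)].
  by apply: (subgroup_comm two_gen_subgroup); exact: two_gen_row.
rewrite baseR; congr base; apply/funext => p.
case: eqP => [->|p0]; first by rewrite !row0.
have [->|/eqP/spread_neq1[k ek]] := eqVneq (row i p) 1.
  by rewrite comm1g.
have [->|/eqP/spread_neq1[l el]] := eqVneq (row j p) 1.
  by rewrite commg1.
by rewrite (rows_meet p0 ek el) commgg.
Qed.

Hypothesis a_surj : forall g, exists k, a k = g.

(** Every commutator of [G] is some [[~ a_i, a_j]] since [a] is onto, so
    commutators of rows give generators of [G'] at 0. *)
Lemma two_gen_spike g : derived g -> two_gen (spike g).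
Proof.
have [H1 HM HV] := two_gen_subgroup.
suff : derived (G := G) `<=` [set x | two_gen (spike x)] by apply.
apply: smallest_sub; last first.
  move=> _ [x _ [y _ <-]].
  by have [i <-] := a_surj x; have [j <-] := a_surj y; apply: two_gen_spike_comm.
split=> [|x y Hx Hy|x Hx] /=.
- suff -> : spike 1 = 1 by [].
  by congr Wreath; apply/funext => p; case: ifP.
- suff -> : spike (x * y) = spike x * spike y by exact: HM.
  by rewrite baseM; congr base; apply/funext => p; case: ifP => // _; rewrite mulg1.
- suff -> : spike x^-1 = (spike x)^-1 by exact: HV.
  by rewrite baseV; congr base; apply/funext => p; case: ifP => // _; rewrite invg1.
Qed.

Variables (B : set nat) (c : nat -> G -> int).
Hypothesis cM : forall l, {morph c l : x y / x * y >-> (x + y)%R}.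
Hypothesis cB : forall k l, B k -> c l (a k) = (l == k)%:Z%R.

(** The only row that can be nontrivial at a nonzero [p]. If there is none, the
    default 0 is harmless: row 0 is then trivial at [p] as well. *)
Definition row_at p : nat := xget 0%N [set i | exists k, (pow2 i + p = pow2 k)%R].

Lemma row_at_eq p i : p <> 0%R -> row i p <> 1 -> row_at p = i.
Proof.
move=> p0 /spread_neq1 ek; apply: xget_unique => // j [l el].
by case: ek => k ek; exact: rows_meet el ek.
Qed.

Definition embed g : wreath G Z := base (fun p : Z =>
  if p == 0%R then g else zpow (row (row_at p) p) (c (row_at p) g)).

Lemma embedM : {morph embed : x y / x * y}.
Proof.
move=> x y; rewrite baseM; congr base; apply/funext => p.
by case: ifP => // _; rewrite cM zpowD.
Qed.

Lemma embed_inj : injective embed.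
Proof. by move=> x y /base_inj/(congr1 (@^~ 0%R)). Qed.

Lemma embed_derived g : derived g -> embed g = spike g.
Proof.
move=> dg; congr base; apply/funext => p; case: ifP => // _.
by rewrite (additive_derived (@cM _) dg) zpow0.
Qed.

(** Off 0, the power that defines [embed (a k)] keeps row [k] and kills the others;
    row [k] itself is trivial at the places that belong to the others. *)
Lemma embed_basis k : B k -> embed (a k) = base (row k : Z -> G).
Proof.
move=> Bk; congr base; apply/funext => p; case: eqP => [->|p0].
  by rewrite row0.
rewrite cB //; case: eqP => [->|ne]; first exact: zpow1.
have [-> //|/eqP r1] := eqVneq (row k p) 1.
by case: ne; exact: row_at_eq.
Qed.

Hypothesis cgen : forall S : set G, subgroup S -> derived (G := G) `<=` S ->
  (forall k, B k -> S (a k)) -> forall x, S x.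

Lemma two_gen_embed g : two_gen (embed g).
Proof.
have [H1 HM HV] := two_gen_subgroup.
apply: (cgen (S := [set x | two_gen (embed x)])).
- have e1 : embed 1 = 1 by apply: (mulgI (embed 1)); rewrite -embedM !mulg1.
  split=> [|x y|x] /=; first by rewrite e1.
    by rewrite embedM; apply: HM.
  suff -> : embed x^-1 = (embed x)^-1 by apply: HV.
  by apply: (mulgI (embed x)); rewrite -embedM !mulgV.
- by move=> x dx /=; rewrite embed_derived //; exact: two_gen_spike.
- by move=> k Bk /=; rewrite embed_basis //; exact: two_gen_row.
Qed.

End Embedding.

Lemma countable_enumeration (T : Type) (x0 : T) :
  countable [set: T] -> exists a : nat -> T, forall x, exists k, a k = x.
Proof.
move=> /countable_injP[r r_inj].
have /choice[a aP] : forall k, exists y, (exists x, r x = k) -> r y = k.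
  move=> k; have [[x rx]|N] := pselect (exists x, r x = k); first by exists x.
  by exists x0 => /N.
exists a => x; exists (r x); apply: r_inj; rewrite ?inE //.
by apply: aP; exists x.
Qed.

Theorem theorem1 (G : groupType)
  (hG : countable [set: G]%classic)
  (hab : free_abelian (abelianization G)) :
  exists H : set (wreath G (Algebra.to_multiplicative int)),
    [/\ subgroup H, k_generated 2 H &
        exists f : {multiplicative G -> wreath G (Algebra.to_multiplicative int)},
          injective f /\ (range f `<=` H)%classic].
Proof.
have [a a_surj] := countable_enumeration (1%g : G) hG.
have [B [c [cM cB cgen]]] := free_abelian_coordinates hab a_surj.
exists (two_gen a); split; first exact: generated_subgroup.
  by exists (gens a).
pose m := isMultiplicative.Build G (wreath G (Algebra.to_multiplicative int))
  _ (embedM a cM).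
pose f : {multiplicative G -> wreath G (Algebra.to_multiplicative int)} :=
  HB.pack (embed a c) m.
exists f; split; first exact: embed_inj.
by move=> _ [g _ <-]; apply: (two_gen_embed a_surj cM cB cgen).
Qed.
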